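(* Let $n\ge2$ and let $f(x)=x^n+a_1x^{n-1}+a_2x^{n-2}+\dots+a_n$ be a monic polynomial all of whose zeros are real and nonnegative, with $a_1\ne0$, and suppose $2na_2\le(n-2)a_1^2$. Let $D_n$ be the span of $f$. Then $$D_n\ge\frac{2a_2-a_1^2}{a_1},$$ and, if $n\ge3$, $$D_n\le\sqrt{\frac2n\left((n-1)a_1^2-2na_2\right)-\frac{1}{n(n-2)}\left(\frac{2na_2-(n-2)a_1^2}{a_1}\right)^2}.$$
   Context: The span of a polynomial $f$ with only real zeros is the length $b-a$ of the smallest interval $[a,b]$ containing all the zeros of $f$. *)

(* Defs.v *)
From mathcomp Require Import all_boot all_order all_algebra.
From mathcomp Require Import all_classical all_reals.
From mathcomp Require Import complex polyrcf.

Set Implicit Arguments.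
Unset Strict Implicit.
Unset Printing Implicit Defensive.

Import Order.TTheory GRing.Theory Num.Theory.

Local Open Scope ring_scope.
Local Open Scope complex_scope.
Local Open Scope classical_set_scope.

Definition zeros (R : realType) (f : {poly R}) : set R := [set x | root f x].

Definition czeros (R : realType) (f : {poly R}) : set R[i] :=
  [set z | root (map_poly (real_complex R) f) z].

Definition smallest_interval (R : realType) (A : set R) (a b : R) : Prop :=
  [/\ a <= b, A `<=` `[a, b]
    & forall c d : R, A `<=` `[c, d] -> `[a, b] `<=` `[c, d] ].

(* Only real zeros are considered, so this is the span of f when f has only
   real zeros. It is a relation: D is unique (is_span_uniq), and exists when
   f is nonconstant with only real zeros (is_span_ex). *)
Definition is_span (R : realType) (f : {poly R}) (D : R) : Prop :=
  exists a b : R, smallest_interval (zeros f) a b /\ D = b - a.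

Lemma is_span_uniq (R : realType) (f : {poly R}) (D D' : R) :
  is_span f D -> is_span f D' -> D = D'.
Proof.
move=> [a [b [[ab sab mab] ->]]] [c [d [[cd scd mcd] ->]]].
have H1 := mab _ _ scd; have H2 := mcd _ _ sab.
have /andP[ca _] : c <= a <= d.
  by have := H1 a; rewrite /= !in_itv /= lexx ab; apply.
have /andP[_ bd] : c <= b <= d.
  by have := H1 b; rewrite /= !in_itv /= lexx ab; apply.
have /andP[ac _] : a <= c <= b.
  by have := H2 c; rewrite /= !in_itv /= lexx cd; apply.
have /andP[_ db] : a <= d <= b.
  by have := H2 d; rewrite /= !in_itv /= lexx cd; apply.
have -> : a = c by apply/eqP; rewrite eq_le ac ca.
by have -> : b = d by apply/eqP; rewrite eq_le bd db.
Qed.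

Lemma is_span_ex (R : realType) (f : {poly R}) :
  (1 < size f)%N -> (forall z, czeros f z -> complex.Im z = 0) ->
  exists D, is_span f D.
Proof.
move=> f1 fre.
have f0 : f != 0 by rewrite -size_poly_gt0 ltnW.
have /closed_rootP[z rz] : size (map_poly (real_complex R) f) != 1%N.
  by rewrite size_map_poly; case: (size f) f1 => [|[|]].
have [x0 rx0] : exists x, root f x.
  have := fre _ rz; case: z rz => x y /= rz y0; subst y; exists x.
  by move: rz; rewrite -[x +i* 0]/(real_complex R x) fmorph_root.
have sE x : (x \in rootsR f) = root f x.
  by rewrite -(roots_on_rootsR f0) in_itv.
pose a := \big[Order.min/x0]_(x <- rootsR f | root f x) x.
pose b := \big[Order.max/x0]_(x <- rootsR f | root f x) x.
have ra : root f a.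
  by rewrite /a; elim/big_ind: _ => // x y rx ry; rewrite minElt; case: ifP.
have rb : root f b.
  by rewrite /b; elim/big_ind: _ => // x y rx ry; rewrite maxElt; case: ifP.
have sab x : root f x -> a <= x <= b.
  by move=> rx; rewrite ge_bigmin_seq ?le_bigmax_seq ?sE.
exists (b - a), a, b; split=> //; split.
- by have /andP[ax xb] := sab _ rx0; exact: le_trans xb.
- by move=> x /sab; rewrite /= in_itv.
- move=> c d scd x; rewrite /= !in_itv /= => /andP[ax xb].
  have := scd _ ra; have := scd _ rb.
  rewrite /= !in_itv /= => /andP[_ bd] /andP[ca _].
  by rewrite (le_trans ca ax) (le_trans xb bd).
Qed.

(* Main.v *)
Require Import Defs.
From mathcomp Require Import all_boot all_order all_algebra.
From mathcomp Require Import all_classical all_reals.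
From mathcomp Require Import complex.
From mathcomp Require Import ring lra.

(** Let [S] and [P] be the sums of the zeros [x] of [f] and of their squares,
    counted with multiplicity, and let [lo] and [hi] be the extreme zeros, so
    that [D = hi - lo].  Vieta's formulas give [a 1 = - S] and
    [2 * a 2 = S ^+ 2 - P]; hence the first bound reads [P / S <= D], and the
    hypothesis on [a 2] reads [2 * S ^+ 2 <= n * P].  Since the zeros lie in
    [[0, hi]], also [P <= hi * S], i.e. [hi >= P / S >= 2 * S / n].

    Lower bound: each [(x - lo) * (hi - x)] is nonnegative, and summing gives
    [P <= (hi - lo) * S - lo * (n * hi - 2 * S)], where the last product is
    nonnegative because [n * hi >= 2 * S].

    Upper bound: keep the two extreme zeros apart and apply Cauchy-Schwarz to
    the other [n - 2] zeros.  With [e = lo + hi - 2 * S / n], this sharpens the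
    classical [D ^+ 2 <= 2 * (P - S ^+ 2 / n)] to
    [D ^+ 2 <= 2 * (P - S ^+ 2 / n) - n / (n - 2) * e ^+ 2].  It remains to
    see that [e >= hi - 2 * S / n >= P / S - 2 * S / n >= 0], so that [e] may be
    replaced by [P / S - 2 * S / n], which depends on the coefficients only. *)

Set Implicit Arguments.
Unset Strict Implicit.
Unset Printing Implicit Defensive.

Import Order.TTheory GRing.Theory Num.Theory.

Local Open Scope ring_scope.
Local Open Scope complex_scope.

(** * Coefficients and zeros of a real-rooted monic polynomial *)

Lemma monic_coefs_form (R : nzRingType) (n : nat) (a : nat -> R) (f : {poly R}) :
  f = 'X^n + \sum_(1 <= k < n.+1) a k *: 'X^(n - k) ->
  [/\ f \is monic, size f = n.+1
    & forall j, (0 < j <= n)%N -> f`_(n - j) = a j].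
Proof.
move=> ->; set g := \sum_(1 <= k < n.+1) _.
have sg : (size g <= n)%N.
  rewrite /g big_nat; apply: (big_ind (fun p : {poly R} => (size p <= n)%N)).
  - by rewrite size_poly0.
  - by move=> p q hp hq; apply: leq_trans (size_polyD _ _) _; rewrite geq_max hp.
  - move=> k /andP[k0 kn]; apply: leq_trans (size_scale_leq _ _) _.
    by rewrite size_polyXn ltn_subrL k0 (leq_trans k0).
split.
- by rewrite monicE lead_coefDl ?lead_coefXn // size_polyXn.
- by rewrite size_polyDl size_polyXn.
- move=> j /andP[j0 jn]; rewrite coefD coefXn ltn_eqF ?add0r; last first.
    by rewrite ltn_subrL j0 (leq_trans j0).
  rewrite coef_sum (bigD1_seq j) ?iota_uniq ?mem_index_iota ?j0 ?ltnS //=.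
  rewrite coefZ coefXn eqxx mulr1 big_nat_cond big1 ?addr0 // => k.
  case/andP=> /andP[_ kn] kj; rewrite coefZ coefXn eqn_sub2lE //.
  by rewrite eq_sym (negPf kj) mulr0.
Qed.

Lemma real_rooted_split (R : realType) (f : {poly R}) :
  f \is monic -> (forall z, czeros f z -> complex.Im z = 0) ->
  exists s : seq R, f = \prod_(x <- s) ('X - x%:P).
Proof.
move=> fm fre.
have [r] := closed_field_poly_normal (map_poly (real_complex R) f).
rewrite lead_coef_map (monicP fm) rmorph1 scale1r => fr.
exists (map (@complex.Re R) r).
apply: (map_poly_inj (real_complex R)); rewrite fr rmorph_prod big_map /=.
apply: eq_big_seq => z zr; rewrite map_polyXsubC.
have : complex.Im z = 0.
  by apply: fre; rewrite /czeros /= fr root_prod_XsubC.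
by case: z {zr} => u v /= ->.
Qed.

(** Multiplying by ['X] and ['X^2] puts the three leading coefficients at the
    common index [size s], also when [size s < 2]; without this shift the
    induction would need truncated subtractions and small cases. *)
Lemma prod_XsubC_vieta (R : comNzRingType) (s : seq R) :
  let p := \prod_(x <- s) ('X - x%:P) in
  [/\ p`_(size s) = 1, (p * 'X)`_(size s) = - \sum_(x <- s) x
    & (p * 'X * 'X)`_(size s) *+ 2
      = (\sum_(x <- s) x) ^+ 2 - \sum_(x <- s) x ^+ 2].
Proof.
elim: s => [|x s [IH0 IH1 IH2]] /=.
  by rewrite !big_nil !coefMX coef1 /= expr0n /= oppr0 mul0rn addr0.
rewrite !big_cons; set p := \prod_(y <- s) _ in IH0 IH1 IH2 *.
have E q : (('X - x%:P) * q)`_(size s).+1 = q`_(size s) - x * q`_(size s).+1.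
  by rewrite mulrBl coefB coefXM coefCM.
have p0 : p`_(size s).+1 = 0.
  by apply: nth_default; rewrite size_prod_XsubC.
rewrite -!mulrA !E; split.
- by rewrite p0 mulr0 subr0.
- by rewrite IH1 coefMX /= IH0 mulr1 opprD addrC.
- rewrite mulrA mulrnBl IH2 coefMX /= IH1; ring.
Qed.

(** * The span as a difference of extreme zeros *)

Lemma seq_extrema (R : realDomainType) (s : seq R) :
  s != [::] -> exists lo hi,
    [/\ lo \in s, hi \in s & forall x, x \in s -> lo <= x <= hi].
Proof.
elim: s => [//|y [|z s] IH] _.
  by exists y, y; split=> [||x]; rewrite inE // => /eqP ->; rewrite lexx.
have [//|lo [hi [lo_s hi_s lohi]]] := IH.
exists (Num.min y lo), (Num.max y hi); split.
- by rewrite minElt inE; case: ifP => _; rewrite ?eqxx // lo_s orbT.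
- by rewrite maxElt inE; case: ifP => _; rewrite ?eqxx // hi_s orbT.
- move=> x; rewrite inE ge_min le_max => /orP[/eqP ->|/lohi /andP[-> ->]].
    by rewrite !lexx.
  by rewrite !orbT.
Qed.

Lemma is_span_extrema (R : realType) (s : seq R) (f : {poly R}) (lo hi : R) :
  f = \prod_(x <- s) ('X - x%:P) ->
  lo \in s -> hi \in s -> (forall x, x \in s -> lo <= x <= hi) ->
  is_span f (hi - lo).
Proof.
move=> fs lo_s hi_s lohi.
have zE x : zeros f x <-> x \in s by rewrite /zeros /= fs root_prod_XsubC.
exists lo, hi; split=> //; split.
- by case/andP: (lohi _ lo_s).
- by move=> x /zE /lohi; rewrite /= in_itv.
- move=> c d sub x; rewrite /= !in_itv /= => /andP[lox xhi].
  have /zE /sub := lo_s; have /zE /sub := hi_s.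
  rewrite /= !in_itv /= => /andP[_ hid] /andP[clo _].
  by rewrite (le_trans clo lox) (le_trans xhi hid).
Qed.

(** * The spread of a sequence against its power sums *)

Lemma sum_quadratic (R : comNzRingType) (s : seq R) (u v w : R) :
  \sum_(x <- s) (u * x ^+ 2 + v * x + w)
  = u * (\sum_(x <- s) x ^+ 2) + v * (\sum_(x <- s) x) + (size s)%:R * w.
Proof.
by rewrite !big_split -!mulr_sumr big_const_seq count_predT iter_addr_0 mulr_natl.
Qed.

(** Cauchy-Schwarz against the constant sequence, from
    [sum (k * x - S) ^+ 2 = k * (k * P - S ^+ 2)]. *)
Lemma sqr_sum_le (R : realDomainType) (s : seq R) :
  (\sum_(x <- s) x) ^+ 2 <= (size s)%:R * \sum_(x <- s) x ^+ 2.
Proof.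
case: s => [|y s]; first by rewrite !big_nil mulr0 expr0n.
set t := y :: s; set k : R := (size t)%:R.
set S := \sum_(x <- t) x; set P := \sum_(x <- t) x ^+ 2.
have k0 : 0 < k by rewrite ltr0n.
have : 0 <= \sum_(x <- t) (k ^+ 2 * x ^+ 2 + (- 2 * k * S) * x + S ^+ 2).
  apply: sumr_ge0 => x _.
  have -> : k ^+ 2 * x ^+ 2 + - 2 * k * S * x + S ^+ 2 = (k * x - S) ^+ 2 by ring.
  exact: sqr_ge0.
rewrite sum_quadratic -/k -/S -/P.
have -> : k ^+ 2 * P + - 2 * k * S * S + k * S ^+ 2 = k * (k * P - S ^+ 2) by ring.
by rewrite pmulr_rge0 // subr_ge0.
Qed.

(** The parabola [x ^+ 2] lies below its chord over [lo <= x <= hi]: the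
    difference is [(x - lo) * (hi - x)]. *)
Lemma sum_sqr_le_chord (R : realDomainType) (s : seq R) (lo hi : R) :
  (forall x, x \in s -> lo <= x <= hi) ->
  \sum_(x <- s) x ^+ 2
  <= (lo + hi) * (\sum_(x <- s) x) - (size s)%:R * (lo * hi).
Proof.
move=> lohi.
have : 0 <= \sum_(x <- s) (- 1 * x ^+ 2 + (lo + hi) * x + - (lo * hi)).
  rewrite big_seq; apply: sumr_ge0 => x /lohi /andP[lox xhi].
  have -> : - 1 * x ^+ 2 + (lo + hi) * x + - (lo * hi) = (x - lo) * (hi - x).
    by ring.
  by rewrite mulr_ge0 ?subr_ge0.
by rewrite sum_quadratic; lra.
Qed.

Section Spread.

Variables (R : realFieldType) (s : seq R) (lo hi : R).
Let n : R := (size s)%:R.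
Let S := \sum_(x <- s) x.
Let P := \sum_(x <- s) x ^+ 2.

Hypotheses (lo_s : lo \in s) (hi_s : hi \in s).
Hypothesis lohi : forall x, x \in s -> lo <= x <= hi.

(** Sz.-Nagy's bound [(hi - lo) ^+ 2 <= 2 * (P - S ^+ 2 / n)] with the
    remainder coming from the other [n - 2] entries; denominators are cleared,
    and [n * (lo + hi) - 2 * S] measures how far the midpoint of the extreme
    entries is from the mean.  Strictness of [lo < hi] ensures that the two
    extremes occupy different positions of [s]. *)
Lemma spread_sqr_le : lo < hi ->
  n * (n - 2) * (hi - lo) ^+ 2
  <= 2 * (n - 2) * (n * P - S ^+ 2) - (n * (lo + hi) - 2 * S) ^+ 2.
Proof.
move=> lt_lohi.
have st : perm_eq s [:: lo, hi & rem hi (rem lo s)].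
  have hi_r : hi \in rem lo s.
    have := hi_s; rewrite (perm_mem (perm_to_rem lo_s)) inE.
    by rewrite gt_eqF.
  by rewrite (perm_trans (perm_to_rem lo_s)) // perm_cons perm_to_rem.
move: (rem hi _) st => t st.
have := sqr_sum_le t; set T := \sum_(x <- t) x; set Q := \sum_(x <- t) x ^+ 2.
have -> : S = lo + (hi + T) by rewrite /S (perm_big _ st) !big_cons.
have -> : P = lo ^+ 2 + (hi ^+ 2 + Q) by rewrite /P (perm_big _ st) !big_cons.
have -> : n = (size t)%:R + 2 by rewrite /n (perm_size st) /= -natrD addn2.
set k : R := (size t)%:R => kQ.
have k0 : 0 <= k by rewrite ler0n.
rewrite -subr_ge0.
set d := (X in 0 <= X).
have -> : d = 2 * (k + 2) * (k * Q - T ^+ 2) by rewrite /d; ring.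
by rewrite mulr_ge0 ?subr_ge0 // mulr_ge0 // addr_ge0.
Qed.

Hypotheses (lo_ge0 : 0 <= lo) (S_gt0 : 0 < S).
Hypothesis PS : 2 * S ^+ 2 <= n * P.

Lemma ratio_le_max : P / S <= hi.
Proof.
rewrite ler_pdivrMr // /P /S mulr_sumr big_seq [leRHS]big_seq.
apply: ler_sum => x /lohi /andP[lox xhi].
by rewrite expr2 ler_wpM2r // (le_trans lo_ge0).
Qed.

Lemma twice_mean_le_ratio : 2 * S <= n * (P / S).
Proof. by rewrite mulrA ler_pdivlMr // -mulrA. Qed.

(** The chord bound is [P <= (hi - lo) * S - lo * (n * hi - 2 * S)], and
    [hi] is at least twice the mean. *)
Lemma ratio_le_spread : P / S <= hi - lo.
Proof.
rewrite ler_pdivrMr //.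
have nhi : 2 * S <= n * hi.
  apply: le_trans twice_mean_le_ratio _.
  by rewrite ler_wpM2l ?ler0n // ratio_le_max.
have := sum_sqr_le_chord lohi; rewrite -/n -/S -/P.
have : 0 <= lo * (n * hi - 2 * S) by rewrite mulr_ge0 ?subr_ge0.
by lra.
Qed.

Lemma spread_sqr_le_ratio : lo < hi -> 2 < n ->
  (hi - lo) ^+ 2
  <= 2 / n * (n * P - S ^+ 2) - 1 / (n * (n - 2)) * (n * (P / S) - 2 * S) ^+ 2.
Proof.
move=> lt_lohi n2.
have n0 : 0 < n by apply: lt_trans n2.
have m0 : 0 < n - 2 by rewrite subr_gt0.
have dev : (n * (P / S) - 2 * S) ^+ 2 <= (n * (lo + hi) - 2 * S) ^+ 2.
  (* both deviations are nonnegative, so they compare like their squares *)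
  have dev0 := twice_mean_le_ratio.
  have dev1 : n * (P / S) <= n * (lo + hi).
    by rewrite ler_wpM2l ?ler0n // (le_trans ratio_le_max) // lerDr.
  by rewrite ler_pXn2r // ?nnegrE ?subr_ge0 ?lerD2r // (le_trans dev0).
rewrite -(ler_pM2l (mulr_gt0 n0 m0)).
have -> : n * (n - 2) * (2 / n * (n * P - S ^+ 2)
            - 1 / (n * (n - 2)) * (n * (P / S) - 2 * S) ^+ 2)
        = 2 * (n - 2) * (n * P - S ^+ 2) - (n * (P / S) - 2 * S) ^+ 2.
  by field; rewrite !gt_eqF.
by apply: le_trans (spread_sqr_le lt_lohi) _; rewrite lerD2l lerN2.
Qed.

End Spread.

(** * The bounds in terms of the coefficients *)

Theorem theorem3p5 (R : realType) (n : nat) (a : nat -> R) (f : {poly R})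
    (D : R)
    (hn : (2 <= n)%N)
    (hf : f = 'X^n + \sum_(1 <= k < n.+1) a k *: 'X^(n - k))
    (hreal : forall z : R[i], czeros f z -> complex.Im z = 0)
    (hnneg : forall z : R[i], czeros f z -> 0 <= complex.Re z)
    (ha1 : a 1%N != 0)
    (ha2 : 2 * n%:R * a 2%N <= (n%:R - 2) * a 1%N ^+ 2)
    (hD : is_span f D) :
  (2 * a 2%N - a 1%N ^+ 2) / a 1%N <= D
  /\ ((3 <= n)%N ->
      D <= Num.sqrt
        (2 / n%:R * ((n%:R - 1) * a 1%N ^+ 2 - 2 * n%:R * a 2%N)
         - 1 / (n%:R * (n%:R - 2))
           * ((2 * n%:R * a 2%N - (n%:R - 2) * a 1%N ^+ 2) / a 1%N) ^+ 2)).
Proof.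
have [fm fsize fcoef] := monic_coefs_form hf.
have [s fs] := real_rooted_split fm hreal.
have [p0 p1 p2] := prod_XsubC_vieta s; rewrite -fs in p0 p1 p2.
have sz : size s = n.
  by apply: succn_inj; rewrite -fsize fs size_prod_XsubC.
set S := \sum_(x <- s) x in p1 p2; set P := \sum_(x <- s) x ^+ 2 in p2.
have a1E : a 1%N = - S.
  by rewrite -p1 sz coefMX -fcoef ?(ltnW hn) // subn1; case: (n) hn.
have a2E : 2 * a 2%N = S ^+ 2 - P.
  rewrite -p2 sz mulr_natl -fcoef ?hn // !coefMX.
  by case: (n) hn => [|[|m]] //= _; rewrite subn2.
have s_ge0 x : x \in s -> 0 <= x.
  move=> xs; have := hnneg x%:C; apply.
  by rewrite /czeros /= fmorph_root fs root_prod_XsubC.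
have S_gt0 : 0 < S.
  rewrite lt_neqAle eq_sym -oppr_eq0 -a1E ha1 /S big_seq.
  by rewrite sumr_ge0.
have PS : 2 * S ^+ 2 <= (size s)%:R * P.
  have : n%:R * (2 * a 2%N) <= (n%:R - 2) * a 1%N ^+ 2 by rewrite mulrCA mulrA.
  by rewrite sz a2E a1E; lra.
have [|lo [hi [lo_s hi_s lohi]]] := @seq_extrema _ s.
  by rewrite -size_eq0 sz -lt0n ltnW.
have lo_ge0 := s_ge0 _ lo_s.
have -> : D = hi - lo.
  exact: is_span_uniq hD (is_span_extrema fs lo_s hi_s lohi).
split.
  have -> : (2 * a 2%N - a 1%N ^+ 2) / a 1%N = P / S.
    by rewrite a2E a1E; field; rewrite gt_eqF.
  exact: (ratio_le_spread lohi lo_ge0 S_gt0 PS).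
move=> n3.
have [<-|lohi_neq] := eqVneq lo hi; first by rewrite subrr sqrtr_ge0.
have lt_lohi : lo < hi.
  by rewrite lt_neqAle lohi_neq; case/andP: (lohi _ lo_s).
have := spread_sqr_le_ratio lo_s hi_s lohi lo_ge0 S_gt0 PS lt_lohi.
rewrite sz ltr_nat => /(_ n3) le_sqr.
rewrite -(ler_sqr) ?nnegrE ?subr_ge0 ?(ltW lt_lohi) ?sqrtr_ge0 //.
set E := (X in _ <= X) in le_sqr.
have ER : 2 / n%:R * ((n%:R - 1) * a 1%N ^+ 2 - 2 * n%:R * a 2%N)
         - 1 / (n%:R * (n%:R - 2))
           * ((2 * n%:R * a 2%N - (n%:R - 2) * a 1%N ^+ 2) / a 1%N) ^+ 2 = E.
  have -> : 2 * n%:R * a 2%N = n%:R * (S ^+ 2 - P) by rewrite -a2E; ring.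
  have n0 : n%:R != 0 :> R by rewrite pnatr_eq0 -lt0n ltnW.
  have m0 : n%:R - 2 != 0 :> R by rewrite subr_eq0 eqr_nat gtn_eqF.
  rewrite a1E /E -/S -/P; move: (n%:R : R) n0 m0 => N n0 m0.
  by field; rewrite n0 m0 gt_eqF.
by rewrite ER sqr_sqrtr // (le_trans _ le_sqr) ?sqr_ge0.
Qed.
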